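(* For all positive integers $n,k,s$, $$\left\lfloor\!\!\left\lfloor\begin{matrix} n\\ k\end{matrix}\right\rfloor\!\!\right\rfloor_{s}\ \ge\ \left\lceil\!\!\left\lceil\begin{matrix} n\\ k\end{matrix}\right\rceil\!\!\right\rceil_{s}\ \ge\ \left[\!\left[\begin{matrix} n\\ k\end{matrix}\right]\!\right]_{s}\ \ge\ \left\{\!\left\{\begin{matrix} n\\ k\end{matrix}\right\}\!\right\}_{s}.$$
   Context: For a partition $\pi=\{b_1,\dots,b_k\}$ of $[n]=\{1,\dots,n\}$ into non-empty blocks, $\operatorname{bl}\pi=\{\min b_1,\dots,\min b_k\}$ (minima with respect to the usual order of integers). A list is a linearly ordered block. The Lah number with higher level (level $s$), $\left\lfloor\!\!\left\lfloor\begin{matrix} n\\ k\end{matrix}\right\rfloor\!\!\right\rfloor_{s}$, is the number of ordered $s$-tuples $(\pi_1,\dots,\pi_s)$ of partitions of $[n]$ into $k$ non-empty lists with $\operatorname{bl}\pi_1=\dots=\operatorname{bl}\pi_s$. The Stirling number of the first kind with higher level, $\left[\!\left[\begin{matrix} n\\ k\end{matrix}\right]\!\right]_{s}$ (resp. of the second kind, $\left\{\!\left\{\begin{matrix} n\\ k\end{matrix}\right\}\!\right\}_{s}$), is the number of ordered $s$-tuples $(\pi_1,\dots,\pi_s)$ of partitions of $[n]$ into $k$ non-empty cyclically ordered blocks (resp. $k$ non-empty unordered blocks) with $\operatorname{bl}\pi_1=\dots=\operatorname{bl}\pi_s$. Equivalently (known), they are determined for $n,k\ge1$ by $\left[\!\left[\begin{matrix}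 n\\ k\end{matrix}\right]\!\right]_{s}=\left[\!\left[\begin{matrix} n-1\\ k-1\end{matrix}\right]\!\right]_{s}+(n-1)^s\left[\!\left[\begin{matrix} n-1\\ k\end{matrix}\right]\!\right]_{s}$ and $\left\{\!\left\{\begin{matrix} n\\ k\end{matrix}\right\}\!\right\}_{s}=\left\{\!\left\{\begin{matrix} n-1\\ k-1\end{matrix}\right\}\!\right\}_{s}+k^s\left\{\!\left\{\begin{matrix} n-1\\ k\end{matrix}\right\}\!\right\}_{s}$, both being $1$ at $(n,k)=(0,0)$ and $0$ at $(n,0)$ and $(0,n)$ for $n>0$. The Lah numbers of order $s$ are defined for integers $n,k\ge0$, $s\ge1$ by $$\left\lceil\!\!\left\lceil\begin{matrix} n\\ k\end{matrix}\right\rceil\!\!\right\rceil_{s}=\sum_{j=k}^{n}\left[\!\left[\begin{matrix} n\\ j\end{matrix}\right]\!\right]_{s}\left\{\!\left\{\begin{matrix} j\\ k\end{matrix}\right\}\!\right\}_{s},$$ and are $0$ for $n<k$. *)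

(* Defs.v *)
From mathcomp Require Import all_boot all_fingroup.

Set Implicit Arguments.
Unset Strict Implicit.
Unset Printing Implicit Defensive.

(* The ground set [n] = {1, ..., n} is 'I_n = {0, ..., n-1}; only its order
   matters. *)

Definition bl n (pi : {set {set 'I_n}}) : {set 'I_n} :=
  [set i | [exists b in pi, (i \in b) && [forall j in b, i <= j]]].

Definition tuples_with_equal_bl n (T : finType) (A : {set T})
    (blocks : T -> {set {set 'I_n}}) (s : nat) : {set {ffun 'I_s -> T}} :=
  [set f : {ffun 'I_s -> T} |
    [forall a, f a \in A] &&
    [forall a, forall b, bl (blocks (f a)) == bl (blocks (f b))]].

Definition set_partitions (n k : nat) : {set {set {set 'I_n}}} :=
  [set pi | partition pi [set: 'I_n] & #|pi| == k].

(* A cyclic order on a block is given by its successor map, so a partition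
   into cyclically ordered blocks is a permutation: the blocks are the orbits,
   and each orbit is cyclically ordered by the permutation. *)
Definition cycle_partitions (n k : nat) : {set 'S_n} :=
  [set p : 'S_n | #|porbits p| == k].

(* A list in [n] has length at most n; n.-bseq 'I_n serves to have a finite
   type of lists. *)
Definition list_partitions (n k : nat) : {set {set n.-bseq 'I_n}} :=
  [set L : {set n.-bseq 'I_n} |
    [&& [forall l in L, (0 < size l) && uniq l],
        [forall i : 'I_n, #|[set l in L | i \in l]| == 1]
      & #|L| == k]].

Definition list_blocks n (L : {set n.-bseq 'I_n}) : {set {set 'I_n}} :=
  [set [set i in l] | l : n.-bseq 'I_n in L].

Definition stirling1_level (s n k : nat) : nat :=
  #|tuples_with_equal_bl (cycle_partitions n k)
      (fun p : 'S_n => porbits p) s|.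

Definition stirling2_level (s n k : nat) : nat :=
  #|tuples_with_equal_bl (set_partitions n k) id s|.

Definition lah_level (s n k : nat) : nat :=
  #|tuples_with_equal_bl (list_partitions n k) (@list_blocks n) s|.

Definition lah_order (s n k : nat) : nat :=
  \sum_(k <= j < n.+1) stirling1_level s n j * stirling2_level s j k.

(* Main.v *)
Require Import Defs.
From mathcomp Require Import all_boot all_fingroup.

Set Implicit Arguments.
Unset Strict Implicit.
Unset Printing Implicit Defensive.

(** The Lah numbers of order [s] count, summed over [j], pairs made of an
    [s]-tuple of permutations of [n] with [j] cycles and a common set of cycle
    minima, and an [s]-tuple of partitions of [j] into [k] blocks with a common
    set of block minima.  Each inequality is a comparison of finite sets.

    The second kind is at most the first: every partition of [n] is the set of
    orbits of some permutation ([porbits_surj]), and the set of minima only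
    depends on the orbits; so [s]-tuples of permutations map onto [s]-tuples of
    partitions.  The first kind is at most the Lah number of order [s], because
    the term [j = k] of the sum is a multiple of it by a positive integer, [k]
    having a partition into singletons.

    For the upper one, Foata's fundamental transformation is applied inside
    each block.  Take a permutation [p] with [j] cycles and a partition [sigma]
    of [j].  Number the cycles by increasing minima, so that a block of [sigma]
    is a set of cycles; write each cycle starting from its minimum, and
    concatenate the cycles of a block by decreasing minima.  This turns
    ([p], [sigma]) into a partition of [n] into lists ([join_cycles]), with one
    list per block of [sigma].  Cutting a list just before each of its
    left-to-right minima recovers the cycles ([canonical_cut_inj]), whence [p],
    then the numbering, then [sigma].  The minima of the lists are determined
    by the cycle minima and by the block minima of [sigma]
    ([bl_join_cycles]); hence, applied to each of the [s] components, the
    transformation sends tuples with equal minima to tuples with equal minima.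
    Equality can fail for [s >= 2] because a tuple of list partitions with equal
    minima may decode to permutations with different cycle minima. *)

(** * Minima of blocks *)

Lemma blP n (P : {set {set 'I_n}}) (i : 'I_n) :
  reflect (exists b, [/\ b \in P, i \in b & forall j : 'I_n, j \in b -> i <= j])
          (i \in bl P).
Proof.
rewrite inE; apply: (iffP exists_inP) => [[b Pb /andP[bi /forall_inP mi]]|].
  by exists b.
by case=> b [Pb bi mi]; exists b => //; rewrite bi; apply/forall_inP.
Qed.

Lemma min_in_bl n (P : {set {set 'I_n}}) b (x : 'I_n) :
  b \in P -> x \in b -> exists2 m, m \in b & m \in bl P.
Proof.
move=> Pb bx; case: (arg_minnP (fun i : 'I_n => i : nat) bx) => m bm min_m.
by exists m => //; apply/blP; exists b.
Qed.

Lemma tuples_with_equal_blP n (T : finType) (A : {set T})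
    (blocks : T -> {set {set 'I_n}}) s (f : {ffun 'I_s -> T}) :
  reflect ((forall a, f a \in A) /\
           forall a b, bl (blocks (f a)) = bl (blocks (f b)))
          (f \in tuples_with_equal_bl A blocks s).
Proof.
rewrite inE; apply: (iffP andP) => -[]; last first.
  move=> fA fbl; split; first exact/forallP.
  by apply/forallP=> a; apply/forallP=> b; apply/eqP.
move=> /forallP fA /forallP fbl; split=> // a b.
by move/forallP/(_ b)/eqP: (fbl a).
Qed.

Lemma sorted_enum_ord n (A : {set 'I_n}) :
  sorted (fun i j : 'I_n => i < j) (enum A).
Proof.
have trans : transitive (fun i j : 'I_n => i < j).
  by move=> j i k; apply: ltn_trans.
rewrite {1}/enum_mem; apply: sorted_filter => //.
by have := iota_ltn_sorted 0 n; rewrite -enumT -val_enum_ord sorted_map.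
Qed.

(** * Cutting a word at its left-to-right minima *)

Section Cut.

Variables (n : nat) (x0 : 'I_n).
Implicit Type ss : seq (seq 'I_n).

(** When the pieces start with their minima and these decrease, the heads of the
    pieces are exactly the left-to-right minima of the concatenation. *)
Definition canonical_cut ss :=
  all (fun u => (u != [::]) && all (fun x : 'I_n => head x0 u <= x) u) ss &&
  sorted (fun u v => head x0 v < head x0 u) ss.

(** The first letter below the head of the first piece [u] is the head of the
    second piece; if there is none, the word is [u] and [find] returns its
    size. *)
Lemma size_first_piece u ss :
  canonical_cut (u :: ss) ->
  size u = find (fun x : 'I_n => x < head x0 u) (flatten (u :: ss)).
Proof.
case/andP=> /= /andP[/andP[_ /allP u_ge] ss_ge] sorted_ss.
rewrite find_cat ifN; last by apply/hasPn=> x ux; rewrite -leqNgt u_ge.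
case: ss ss_ge sorted_ss => [|[|y v] ss] //=; first by rewrite addn0.
by move=> _ /andP[-> _]; rewrite addn0.
Qed.

Lemma canonical_cut_behead u ss : canonical_cut (u :: ss) -> canonical_cut ss.
Proof.
case/andP=> /= /andP[_ min_ss] /path_sorted sorted_ss.
by rewrite /canonical_cut min_ss.
Qed.

(** The head of the first piece is the first letter of the word, and then
    [size_first_piece] reads the length of that piece off the word. *)
Lemma canonical_cut_inj : {in canonical_cut &, injective flatten}.
Proof.
elim=> [|u ss IHss] [|v tt] //.
- by move=> _ /andP[/= /andP[]]; case: v.
- by move=> /andP[/= /andP[]]; case: u.
move=> cut_ss cut_tt eq_w.
have eq_head : head x0 u = head x0 v.
  have /andP[/= /andP[/andP[u0 _] _] _] := cut_ss.
  have /andP[/= /andP[/andP[v0 _] _] _] := cut_tt.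
  by case: u v u0 v0 eq_w {cut_ss cut_tt} => [|x u] [|y v] //= _ _ [->].
have eq_size : size u = size v.
  by rewrite (size_first_piece cut_ss) (size_first_piece cut_tt) eq_w eq_head.
have /andP[/eqP-> /eqP eq_w'] : (u == v) && (flatten ss == flatten tt).
  by rewrite -eqseq_cat //; apply/eqP.
congr cons; apply: IHss eq_w'.
  exact: canonical_cut_behead cut_ss.
exact: canonical_cut_behead cut_tt.
Qed.

End Cut.

(** * First and second kind *)

Lemma porbit_orbit n (p : 'S_n) x : porbit p x =i fingraph.orbit p x.
Proof.
move=> y; rewrite -fconnect_orbit; apply/porbitP/idP => [[i ->]|xy].
  by rewrite permX fconnect_iter.
by exists (findex p x y); rewrite permX iter_findex.
Qed.

(** The permutation sends each element to the cyclically next one in the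
    enumeration of its block. *)
Lemma porbits_surj n (P : {set {set 'I_n}}) :
  partition P [set: 'I_n] -> exists p : 'S_n, porbits p = P.
Proof.
case/and3P=> /eqP covP trivP P0.
pose blk x := pblock P x.
have mem_blk x : x \in enum (blk x).
  by rewrite mem_enum mem_pblock covP inE.
pose nxt x := next (enum (blk x)) x.
have blk_eq x y : y \in blk x -> blk y = blk x by apply: same_pblock.
have nxt_blk x : blk (nxt x) = blk x.
  by apply: blk_eq; rewrite -mem_enum mem_next.
have nxt_inj : injective nxt.
  move=> x y eq_nxt; have eq_blk : blk x = blk y.
    by rewrite -nxt_blk eq_nxt nxt_blk.
  rewrite -[x](prev_next (enum_uniq (mem (blk x)))) -/(nxt x) eq_nxt eq_blk.
  by rewrite prev_next ?enum_uniq.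
pose p := perm nxt_inj.
have p_cycle x : fcycle p (enum (blk x)).
  have := cycle_next (enum_uniq (mem (blk x))).
  apply: sub_in_cycle (allss _) => y z yx zx /=.
  by rewrite permE /nxt (blk_eq x) // -mem_enum.
have porbit_blk x : porbit p x = blk x.
  apply/setP=> y; rewrite porbit_orbit -fconnect_orbit.
  by rewrite (fconnect_cycle (p_cycle x)) ?mem_enum // -mem_enum.
exists p; apply/setP=> b; apply/imsetP/idP=> [[x _ ->]|Pb].
  by rewrite porbit_blk pblock_mem ?covP ?inE.
have [b0|[x bx]] := set_0Vmem b; first by rewrite -b0 Pb in P0.
by exists x => //; rewrite porbit_blk /blk (def_pblock trivP Pb).
Qed.

Lemma stirling2_le_stirling1 s n k :
  stirling2_level s n k <= stirling1_level s n k.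
Proof.
pose orbits (f : {ffun 'I_s -> 'S_n}) := [ffun a => porbits (f a)].
apply: leq_trans (leq_imset_card orbits _).
apply/subset_leq_card/subsetP=> g /tuples_with_equal_blP[gA gbl].
have ex_p a : exists p : 'S_n, porbits p == g a.
  have := gA a; rewrite inE => /andP[/porbits_surj[p <-] _].
  by exists p.
pose f := [ffun a => xchoose (ex_p a)].
have fE a : porbits (f a) = g a by rewrite ffunE; apply/eqP/(xchooseP (ex_p a)).
apply/imsetP; exists f; last by apply/ffunP=> a; rewrite ffunE fE.
apply/tuples_with_equal_blP; split=> [a|a b]; last by rewrite !fE; apply: gbl.
by have := gA a; rewrite !inE fE => /andP[].
Qed.

Lemma stirling2_diag_gt0 s k : 0 < stirling2_level s k k.
Proof.
pose P := [set [set i] | i in [set: 'I_k]].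
apply/card_gt0P; exists [ffun=> P]; apply/tuples_with_equal_blP.
split=> [a|a b]; last by rewrite !ffunE.
rewrite !ffunE inE card_imset ?cardsT ?card_ord ?eqxx ?andbT;
  last exact: set1_inj.
have -> : P = preim_partition id [set: 'I_k].
  apply/setP=> b; apply/imsetP/imsetP=> -[x _ ->]; exists x => //.
    by apply/setP=> y; rewrite !inE eq_sym.
  by apply/setP=> y; rewrite !inE eq_sym.
exact: preim_partitionP.
Qed.

Lemma stirling1_eq0 s n k : 0 < s -> n < k -> stirling1_level s n k = 0.
Proof.
case: s => // s _ lt_nk; apply/eqP; rewrite cards_eq0; apply/eqP/setP=> f.
rewrite !inE; apply/negP=> /andP[/forallP/(_ ord0)]; rewrite inE => /eqP card_f.
have := leq_imset_card (porbit (f ord0)) [set: 'I_n].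
rewrite cardsT card_ord (_ : porbit (f ord0) @: _ = porbits (f ord0)).
  by rewrite card_f leqNgt lt_nk.
by apply/setP=> b; apply/imsetP/imsetP=> -[x _ ->]; exists x.
Qed.

Lemma stirling1_le_lah_order s n k :
  0 < s -> stirling1_level s n k <= lah_order s n k.
Proof.
move=> s_gt0; have [le_kn|lt_nk] := leqP k n; last by rewrite stirling1_eq0.
rewrite /lah_order big_ltn //; apply: leq_trans (leq_addr _ _).
by rewrite leq_pmulr // stirling2_diag_gt0.
Qed.

(** * Joining cycles into lists *)

Section Cycles.

Variables (n : nat) (x0 : 'I_n).

(** The [c]-th cycle minimum, in increasing order; [x0] is reached only when
    [p] has at most [c] cycles. *)
Definition leader (p : 'S_n) j (c : 'I_j) : 'I_n :=
  nth x0 (enum (bl (porbits p))) c.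

(** [enum C] is increasing and [orbit p x] starts with [x], so the cycles are
    listed from their minima, by decreasing minima. *)
Definition word (p : 'S_n) j (C : {set 'I_j}) : seq 'I_n :=
  flatten [seq fingraph.orbit p (leader p c) | c <- rev (enum C)].

Definition join_cycles (p : 'S_n) j (sigma : {set {set 'I_j}}) :
    {set n.-bseq 'I_n} :=
  [set insub_bseq n (word p C) | C : {set 'I_j} in sigma].

Lemma mem_porbits (p : 'S_n) x : porbit p x \in porbits p.
Proof. exact: imset_f. Qed.

Lemma bl_porbitP (p : 'S_n) (i : 'I_n) :
  reflect (forall j : 'I_n, j \in porbit p i -> i <= j) (i \in bl (porbits p)).
Proof.
apply: (iffP (blP _ _)) => [[b [/imsetP[x _ ->] ix min_i]]|min_i].
  by move: ix; rewrite -eq_porbit_mem => /eqP->.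
by exists (porbit p i); split=> //; [apply: mem_porbits | apply: porbit_id].
Qed.

(** Two cycle minima in the same orbit are each below the other. *)
Lemma bl_porbit_inj (p : 'S_n) :
  {in bl (porbits p) &, injective (porbit p)}.
Proof.
move=> i j /bl_porbitP min_i /bl_porbitP min_j eq_ij.
apply/val_inj/anti_leq; rewrite min_i ?min_j // ?eq_ij ?porbit_id //.
by rewrite -eq_ij porbit_id.
Qed.

Lemma card_bl_porbits (p : 'S_n) : #|bl (porbits p)| = #|porbits p|.
Proof.
rewrite -(card_in_imset (@bl_porbit_inj p)); apply: eq_card => b.
apply/imsetP/imsetP=> -[x Px ->]; first by exists x.
have [m xm bl_m] := min_in_bl (mem_porbits p x) (porbit_id p x).
by exists m => //; apply/eqP; rewrite eq_sym eq_porbit_mem.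
Qed.

Section OnePermutation.

Variables (p : 'S_n) (j : nat).
Hypothesis card_p : #|porbits p| = j.

Lemma leader_bl (c : 'I_j) : leader p c \in bl (porbits p).
Proof. by rewrite -mem_enum mem_nth // -cardE card_bl_porbits card_p. Qed.

Lemma bl_leader i : i \in bl (porbits p) -> exists c : 'I_j, i = leader p c.
Proof.
rewrite -mem_enum => bl_i.
have lt_ij : index i (enum (bl (porbits p))) < j.
  by rewrite -card_p -card_bl_porbits cardE index_mem.
by exists (Ordinal lt_ij); rewrite /leader nth_index.
Qed.

Lemma leader_mono : {mono (fun c : 'I_j => leader p c) : c d / c < d}.
Proof.
have lt_mono (c d : 'I_j) : c < d -> leader p c < leader p d.
  apply: (sorted_ltn_nth _ _ (sorted_enum_ord _)).
  - by move=> ? ? ?; apply: ltn_trans.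
  - by rewrite inE -cardE card_bl_porbits card_p.
  - by rewrite inE -cardE card_bl_porbits card_p.
move=> c d; case: (ltngtP c d) => [/lt_mono->|/lt_mono/ltnW|/val_inj->] //.
  by rewrite leqNgt => /negbTE.
by rewrite ltnn.
Qed.

Lemma leader_inj : injective (fun c : 'I_j => leader p c).
Proof.
move=> c d eq_cd; apply/val_inj/eqP; rewrite eqn_leq leqNgt -leader_mono eq_cd.
by rewrite ltnn leqNgt -leader_mono eq_cd ltnn.
Qed.

Lemma leader_of x : exists c : 'I_j, x \in porbit p (leader p c).
Proof.
have [m xm /bl_leader[c def_m]] :=
  min_in_bl (mem_porbits p x) (porbit_id p x).
by exists c; rewrite -def_m porbit_sym.
Qed.

Lemma leader_uniq (c d : 'I_j) x :
  x \in porbit p (leader p c) -> x \in porbit p (leader p d) -> c = d.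
Proof.
rewrite -!eq_porbit_mem => /eqP xc /eqP xd.
by apply: leader_inj; apply: (@bl_porbit_inj p); rewrite /= ?leader_bl -?xc.
Qed.

Lemma mem_word (C : {set 'I_j}) x :
  reflect (exists2 c, c \in C & x \in porbit p (leader p c)) (x \in word p C).
Proof.
apply: (iffP flatten_mapP) => -[c]; rewrite ?mem_rev ?mem_enum => Cc xc.
  by exists c; rewrite ?porbit_orbit.
by exists c; rewrite ?mem_rev ?mem_enum -?porbit_orbit.
Qed.

Lemma word_uniq (C : {set 'I_j}) : uniq (word p C).
Proof.
rewrite /word; have: uniq (rev (enum C)) by rewrite rev_uniq enum_uniq.
elim: (rev _) => //= c s IHs /andP[s'c /IHs uniq_s].
rewrite cat_uniq orbit_uniq uniq_s andbT /=.
apply/hasPn=> x /flatten_mapP[d sd xd]; apply/negP=> xc.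
case/negP: s'c; by rewrite (@leader_uniq c d x) // porbit_orbit.
Qed.

Lemma head_orbit (x : 'I_n) : head x0 (fingraph.orbit p x) = x.
Proof. by rewrite /fingraph.orbit -orderSpred. Qed.

Lemma canonical_cut_word (C : {set 'I_j}) :
  canonical_cut x0 [seq fingraph.orbit p (leader p c) | c <- rev (enum C)].
Proof.
apply/andP; split.
  apply/allP=> _ /mapP[c _ ->].
  have /bl_porbitP min_c := leader_bl c.
  rewrite head_orbit; apply/andP; split.
    by rewrite /fingraph.orbit -orderSpred.
  by apply/allP=> x; rewrite -porbit_orbit => /min_c.
rewrite sorted_map rev_sorted; apply: sub_sorted (sorted_enum_ord C) => c d.
by rewrite /= !head_orbit leader_mono.
Qed.

End OnePermutation.

Lemma val_word p j (C : {set 'I_j}) :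
  #|porbits p| = j -> insub_bseq n (word p C) = word p C :> seq 'I_n.
Proof.
move=> card_p; have size_w : size (word p C) <= n.
  have /card_uniqP <- := word_uniq card_p C.
  by rewrite (leq_trans (max_card _)) ?card_ord.
by rewrite /insub_bseq insubdK.
Qed.

Lemma mem_insub_word p j (C : {set 'I_j}) x :
  #|porbits p| = j -> (x \in insub_bseq n (word p C)) = (x \in word p C).
Proof. by move=> card_p; rewrite -[LHS]/(x \in bseqval _) val_word. Qed.

Lemma word_inj p j : #|porbits p| = j -> injective (@word p j).
Proof.
move=> card_p C D eq_w; apply/setP=> c.
have cutCD := canonical_cut_inj
  (canonical_cut_word card_p C) (canonical_cut_word card_p D) eq_w.
have eq_leaders :
    map (@leader p j) (rev (enum C)) = map (@leader p j) (rev (enum D)).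
  have := congr1 (map (head x0)) cutCD.
  by rewrite -!map_comp !(eq_map (fun d => head_orbit p (leader p d))).
have := inj_map (leader_inj card_p) eq_leaders.
by move/(congr1 (fun s : seq 'I_j => c \in s)); rewrite !mem_rev !mem_enum.
Qed.

(** Equal words have equal cuts, so the cycle of [p] through [x] is a cycle of
    [q], written from the same starting point. *)
Lemma word_eq_perm p q i j (C : {set 'I_i}) (D : {set 'I_j}) :
  #|porbits p| = i -> #|porbits q| = j -> word p C = word q D ->
  {in word p C, p =1 q}.
Proof.
move=> card_p card_q eq_w x /flatten_mapP[c Cc xc].
have cutCD := canonical_cut_inj
  (canonical_cut_word card_p C) (canonical_cut_word card_q D) eq_w.
have := map_f (fun c => fingraph.orbit p (leader p c)) Cc.
rewrite cutCD => /mapP[d _ eq_o].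
have /eqP -> := next_cycle (cycle_orbit (@perm_inj _ p) _) xc.
rewrite eq_o in xc *.
by have /eqP -> := next_cycle (cycle_orbit (@perm_inj _ q) _) xc.
Qed.

Lemma insub_word_inj p j :
  #|porbits p| = j -> injective (fun C : {set 'I_j} => insub_bseq n (word p C)).
Proof.
move=> card_p C D /(congr1 val) /=; rewrite -![val _]/(bseqval _) !val_word //.
exact: word_inj.
Qed.

(** Since [sigma] covers all cycles of [p], every point lies in a word, and the
    equal word on the other side determines its image.  The numbers of cycles
    [i] and [j] are kept distinct because their equality is deduced from
    [p = q]. *)
Lemma join_cycles_eq_perm p q i j
    (sigma : {set {set 'I_i}}) (tau : {set {set 'I_j}}) :
  #|porbits p| = i -> #|porbits q| = j -> cover sigma = [set: 'I_i] ->
  join_cycles p sigma = join_cycles q tau -> p = q.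
Proof.
move=> card_p card_q cov eq_L; apply/permP=> x.
have [c xc] := leader_of card_p x.
have /bigcupP[C sC Cc] : c \in cover sigma by rewrite cov inE.
have /imsetP[D _ /(congr1 (@bseqval n _))] :
    insub_bseq n (word p C) \in join_cycles q tau.
  by rewrite -eq_L; apply: imset_f.
rewrite !val_word // => eq_w; apply: (word_eq_perm card_p card_q eq_w).
by apply/mem_word; exists c.
Qed.

Lemma join_cycles_inj p j : #|porbits p| = j -> injective (@join_cycles p j).
Proof. by move=> card_p; apply/imset_inj/insub_word_inj. Qed.

(** A point lies in exactly one cycle, and the number of that cycle lies in
    exactly one block of [sigma]. *)
Lemma join_cycles_list_partition p j k (sigma : {set {set 'I_j}}) :
  #|porbits p| = j -> sigma \in set_partitions j k ->
  join_cycles p sigma \in list_partitions n k.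
Proof.
move=> card_p; rewrite inE => /andP[/and3P[/eqP cov triv s0] /eqP card_s].
rewrite inE; apply/and3P; split.
- apply/forall_inP=> _ /imsetP[C sC ->].
  rewrite val_word // (word_uniq card_p) andbT -has_predT; apply/hasP.
  have [C0|[c Cc]] := set_0Vmem C; first by rewrite -C0 sC in s0.
  exists (leader p c) => //; apply/mem_word.
  by exists c => //; apply: porbit_id.
- apply/forallP=> x; have [c xc] := leader_of card_p x.
  have /bigcupP[C sC Cc] : c \in cover sigma by rewrite cov inE.
  apply/cards1P; exists (insub_bseq n (word p C)); apply/setP=> l; rewrite !inE.
  apply/andP/eqP=> [[/imsetP[D sD ->]]|->].
    rewrite mem_insub_word // => /mem_word[d Dd xd].
    have eq_dc := leader_uniq card_p xd xc; rewrite eq_dc in Dd.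
    by rewrite -(def_pblock triv sC Cc) (def_pblock triv sD Dd).
  split; first exact: imset_f.
  by rewrite mem_insub_word //; apply/mem_word; exists c.
- by rewrite card_imset ?card_s //; apply: insub_word_inj.
Qed.

Lemma leader_le_porbit p j (c : 'I_j) x :
  #|porbits p| = j -> x \in porbit p (leader p c) -> leader p c <= x.
Proof. by move=> card_p; apply/bl_porbitP/leader_bl. Qed.

(** The right-hand side depends on [p] only through its cycle minima and on
    [sigma] only through its block minima; this is what carries equality of
    minima across a tuple. *)
Lemma bl_join_cycles p j (sigma : {set {set 'I_j}}) :
  #|porbits p| = j ->
  bl (list_blocks (join_cycles p sigma)) = [set leader p c | c in bl sigma].
Proof.
move=> card_p; have le_leader (c d : 'I_j) :
    (leader p c <= leader p d) = (c <= d).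
  by rewrite leqNgt (leader_mono card_p) -leqNgt.
apply/setP=> x; apply/blP/imsetP=> [[b []]|[c /blP[C [sC Cc min_c]] ->]].
  case/imsetP=> _ /imsetP[C sC ->] ->.
  rewrite inE mem_insub_word // => /mem_word[c Cc xc] min_x.
  have def_x : x = leader p c.
    apply/val_inj/anti_leq; rewrite leader_le_porbit // min_x // inE.
    rewrite mem_insub_word //.
    by apply/mem_word; exists c; rewrite ?porbit_id.
  exists c => //; apply/blP; exists C; split=> // d Cd.
  rewrite -le_leader -def_x min_x // inE mem_insub_word //.
  by apply/mem_word; exists d; rewrite ?porbit_id.
exists [set i in insub_bseq n (word p C)]; split.
- by apply: imset_f; apply: imset_f.
- rewrite inE mem_insub_word //.
  by apply/mem_word; exists c; rewrite ?porbit_id.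
- move=> i; rewrite inE mem_insub_word // => /mem_word[d Cd xd].
  by apply: leq_trans (leader_le_porbit card_p xd); rewrite le_leader min_c.
Qed.

End Cycles.

(** * Counting tuples *)

Section TupleCount.

Variables (n k s : nat) (x0 : 'I_n).
Hypothesis s_gt0 : 0 < s.

Let J (j : 'I_n.+1) : finType :=
  ({ffun 'I_s -> 'S_n} * {ffun 'I_s -> {set {set 'I_j}}})%type.

(** The pairs of tuples for all [j] at once: the second component lives over
    [j], hence the dependent sum. *)
Definition level_pairs : {set {j : 'I_n.+1 & J j}} :=
  [set u : {j : 'I_n.+1 & J j} |
    ((tagged u).1 \in tuples_with_equal_bl (cycle_partitions n (tag u))
                        (fun p : 'S_n => porbits p) s) &&
    ((tagged u).2 \in tuples_with_equal_bl (set_partitions (tag u) k) id s)].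

Lemma lah_order_le_card_pairs : lah_order s n k <= #|level_pairs|.
Proof.
rewrite /lah_order big_geq_mkord big_mkcond /=.
rewrite -sum1_card /level_pairs.
under [X in _ <= X]eq_bigl do rewrite inE.
rewrite -(sig_big_dep (J := J) (fun=> true)
  (fun j (u : J j) =>
    (u.1 \in tuples_with_equal_bl (cycle_partitions n j)
       (fun p : 'S_n => porbits p) s) &&
    (u.2 \in tuples_with_equal_bl (set_partitions j k) id s)) (fun _ _ => 1)).
apply: leq_sum => j _; case: ifP => // _.
rewrite /stirling1_level /stirling2_level -cardsX -sum1_card.
by apply: eq_leq; apply: eq_bigl => u; rewrite inE.
Qed.

Definition join_levels (u : {j : 'I_n.+1 & J j}) :
    {ffun 'I_s -> {set n.-bseq 'I_n}} :=
  [ffun a => join_cycles x0 ((tagged u).1 a) ((tagged u).2 a)].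

(** Since [s > 0], the number [j] can be read off a component, as its number of
    cycles. *)
Lemma join_levels_inj : {in level_pairs &, injective join_levels}.
Proof.
move=> [i [P S]] [j [Q T]]; rewrite inE /=.
case/andP=> /tuples_with_equal_blP[cP _] /tuples_with_equal_blP[cS _].
rewrite inE /= => /andP[].
move=> /tuples_with_equal_blP[cQ _] /tuples_with_equal_blP[cT _].
move/ffunP=> eq_join.
have {}cP a : #|porbits (P a)| = i by have := cP a; rewrite inE => /eqP.
have {}cQ a : #|porbits (Q a)| = j by have := cQ a; rewrite inE => /eqP.
have eq_PQ : P = Q.
  apply/ffunP=> a; have := eq_join a; rewrite !ffunE /=.
  apply: join_cycles_eq_perm => //.
  by have := cS a; rewrite inE => /andP[/and3P[/eqP]].
pose a0 : 'I_s := Ordinal s_gt0.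
have eq_ij : i = j by apply/val_inj; rewrite /= -(cP a0) eq_PQ cQ.
subst j; subst Q; suff -> : S = T by []; apply/ffunP=> a.
have := eq_join a; rewrite !ffunE /=; exact: join_cycles_inj.
Qed.

Lemma join_levels_list_partitions u :
  u \in level_pairs ->
  join_levels u \in
    tuples_with_equal_bl (list_partitions n k) (@list_blocks n) s.
Proof.
case: u => [j [P S]]; rewrite inE /=.
case/andP=> /tuples_with_equal_blP[cP blP] /tuples_with_equal_blP[cS blS].
have {}cP a : #|porbits (P a)| = j by have := cP a; rewrite inE => /eqP.
apply/tuples_with_equal_blP; split=> [a|a b]; rewrite !ffunE /=.
  exact: join_cycles_list_partition (cP a) (cS a).
rewrite !bl_join_cycles // (blS a b); apply: eq_imset => c.
by rewrite /leader (blP a b).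
Qed.

Lemma lah_order_le_lah_level : lah_order s n k <= lah_level s n k.
Proof.
apply: leq_trans lah_order_le_card_pairs _.
rewrite -(card_in_imset join_levels_inj); apply/subset_leq_card/subsetP.
by move=> _ /imsetP[u /join_levels_list_partitions lu ->].
Qed.

End TupleCount.

Theorem theorem4p2 (n k s : nat) (hn : 0 < n) (hk : 0 < k) (hs : 0 < s) :
  [/\ lah_level s n k >= lah_order s n k,
      lah_order s n k >= stirling1_level s n k
    & stirling1_level s n k >= stirling2_level s n k].
Proof.
split; last exact: stirling2_le_stirling1.
  exact: lah_order_le_lah_level (Ordinal hn) hs.
exact: stirling1_le_lah_order.
Qed.
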